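(* Let $(\mathbb{A},+)$ be a finite Abelian group with $|\mathbb{A}|\ge 2$. The filtration $\mathscr{F}^{\tau^{-1}}$ associated with the deterministic cellular automaton $\tau x(i)=x(i)+x(i+1)$ on $\mathbb{A}^{\mathbb{Z}}$ is of product type.
   Context: Conventions: probability spaces are Polish spaces with their Borel $\sigma$-algebra; random variables take values in Polish spaces. $\Sigma(X_m:m\in I)$ denotes the $\sigma$-algebra generated by the random variables $X_m$, $m\in I$, and the negligible sets; all $\sigma$-algebras are complete and essentially separable (generated modulo negligible sets by countably many events). A filtration is a non-decreasing sequence $\mathscr{F}=(\mathscr{F}_n)_{n\le 0}$ of sub-$\sigma$-algebras on a probability space; it is generated by a process $(X_n)_{n\le0}$ if $\mathscr{F}_n=\Sigma(X_m:m\le n)$ for every $n\le 0$. A filtration is of product type if it can be generated by a process $(Y_n)_{n\le 0}$ formed of independent random variables. Construction of $\mathscr{F}^{\tau^{-1}}$: $\tau:\mathbb{A}^{\mathbb{Z}}\to\mathbb{A}^{\mathbb{Z}}$ is defined by $\tau x(i)=x(i)+x(i+1)$ for $i\in\mathbb{Z}$. Let $\mu$ be the product measure on $\mathbb{A}^{\mathbb{Z}}$ whose marginals are uniform on $\mathbb{A}$; it is $\tau$-invariant. On the probability space $(\mathbb{A}^{\mathbb{Z}},\mu)$ let $X_0$ be the identity map and $X_n:=\tau^{|n|}X_0$ for every integer $n\le 0$ (so $X_{n-1}=\tau X_n$). Then $\mathscr{F}^{\tau^{-1}}$ is the filtration generated by $(X_n)_{n\le0}$. *)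

(* Defs.v *)
From HB Require Import structures.
From mathcomp Require Import all_boot all_order all_algebra finmap.
From mathcomp Require Import all_classical all_reals all_analysis.

Set Implicit Arguments.
Unset Strict Implicit.
Unset Printing Implicit Defensive.

Import Order.TTheory GRing.Theory Num.Theory.
Import numFieldNormedType.Exports.

Local Open Scope classical_set_scope.
Local Open Scope ring_scope.

(* Separable and completely metrizable. A Hausdorff pseudometric is a metric,
   so the second clause says that T is homeomorphic to a complete metric
   space. *)
Definition polish_space (R : realType) (T : ptopologicalType) : Prop :=
  (exists2 D : set T, countable D & dense D) /\
  exists (M : completePseudoMetricType R) (f : T -> M) (g : M -> T),
    [/\ hausdorff_space M, cancel f g, cancel g f,
        continuous f & continuous g].

Notation borel T := (g_sigma_algebraType (@open T)).

Section Processes.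
Context (d : measure_display) (T : measurableType d) (R : realType).
Variable P : probability T R.

(* Processes are indexed by all of int; only the indices n <= 0 matter below.
   The space in which the variable of index n takes its values may depend
   on n. *)
Context (E : int -> ptopologicalType) (X : forall n, T -> E n).

(* P.-negligible contains every subset of a measurable P-null set, so the
   elements of Sigma I need not be measurable in T. *)
Definition Sigma (I : set int) : set (set T) :=
  <<s (\bigcup_(m in I)
         preimage_set_system setT (X m) (@measurable _ (borel (E m))))
      `|` P.-negligible >>.

Definition generated_filtration (n : int) : set (set T) :=
  Sigma [set m : int | m <= n].

Definition random_process : Prop :=
  forall n : int, n <= 0 -> measurable_fun setT (X n : T -> borel (E n)).

Definition independent_process : Prop :=
  forall (J : {fset int}) (B : forall n, set (E n)),
    (forall n, n \in J -> n <= 0) ->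
    (forall n, n \in J -> @measurable _ (borel (E n)) (B n)) ->
    P (\bigcap_(n in [set` J]) (X n @^-1` B n)) =
      (\prod_(n <- J) P (X n @^-1` B n))%E.

End Processes.

Definition product_type (d : measure_display) (T : measurableType d)
    (R : realType) (P : probability T R) (F : int -> set (set T)) : Prop :=
  exists (E : int -> ptopologicalType) (Y : forall n, T -> E n),
    [/\ forall n, polish_space R (E n),
        random_process Y,
        independent_process P Y &
        forall n : int, n <= 0 -> F n = generated_filtration P Y n].

(* A^Z with the product of the discrete topologies. *)
Definition config (A : finZmodType) : Type :=
  prod_topology (fun _ : int => discrete_topology A).

HB.instance Definition _ (A : finZmodType) := Topological.on (config A).
HB.instance Definition _ (A : finZmodType) :=
  isPointed.Build (config A) (fun=> 0 : A).

Section Automaton.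
Variable A : finZmodType.
Local Notation config := (config A).

Definition tau (x : config) : config := fun i : int => (x i : A) + x (i + 1).

Definition tau_process (n : int) : borel config -> config :=
  fun x => iter `|n|%N tau x.

(* By uniqueness of the extension from cylinders, this characterizes the
   product of the uniform probability measures on A. *)
Definition uniform_product_measure (R : realType)
    (mu : probability (borel config) R) : Prop :=
  forall (J : {fset int}) (B : int -> {set A}),
    mu [set x : config | forall i, i \in J -> (x i : A) \in B i] =
      (\prod_(i <- J) (#|B i|%:R / #|A|%:R))%:E.

Definition tau_filtration (R : realType) (mu : probability (borel config) R) :
    int -> set (set (borel config)) :=
  generated_filtration mu tau_process.

End Automaton.

(* Main.v *)
From HB Require Import structures.
From mathcomp Require Import finmap.
From mathcomp Require Import all_boot all_order all_algebra zify.
From mathcomp Require Import all_classical all_reals all_analysis.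
Require Import Defs.
Set Implicit Arguments.
Unset Strict Implicit.
Unset Printing Implicit Defensive.

Import Order.TTheory GRing.Theory Num.Theory.
Import numFieldNormedType.Exports.

Local Open Scope classical_set_scope.
Local Open Scope ring_scope.

(** Throughout, X_k, for k in nat, is the k-th iterate of tau on the random
    configuration, so that [tau_process] at time -k is X_k. The filtration is
    generated by the independent variables

      Y_k := X_k (cell k),    cell k := - (k / 2)   (rounded down),

    one letter being read at each time, at a place that moves to the left at
    half the speed at which the dependence cone of tau widens.

    Since tau x i = x i + x (i + 1) in a group, once X_(k+1) is known on an
    interval of length m + 1, a single letter of X_k on the corresponding
    interval of length m + 2 gives all of X_k there: subtract on the way right
    and on the way left. By induction, Y_k, ..., Y_(k+m) determine X_k on the
    interval of the m + 1 cells that starts at cell (k + m)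
    ([spread_window]). As cell (k + m) goes to minus infinity and
    cell (k + m) + m to plus infinity, the Y_l with l >= k determine the whole
    of X_k ([spread_everywhere]), and no negligible set is involved: this gives
    the equality of the filtrations ([tau_filtrationE]).

    For independence, the case k = 0 says that the map from the letters of the
    initial configuration on the N + 1 cells from cell N on to the values of
    Y_0, ..., Y_N is injective. Both sides range over A^(N+1), so this map is a
    bijection, and it carries the uniform law to the uniform law
    ([mu_readings]): the Y_k are independent and uniform on A. *)

(** * The alphabet as a discrete Polish space *)

(** An alias of A, carrying the discrete topology, on which 0 can serve as the
    distinguished point. *)
Definition letter (A : finZmodType) : Type := discrete_topology A.

HB.instance Definition _ (A : finZmodType) := Finite.copy (letter A) A.
HB.instance Definition _ (A : finZmodType) :=
  isPointed.Build (letter A) (0 : A).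
HB.instance Definition _ (A : finZmodType) :=
  hasNbhs.Build (letter A) principal_filter.
HB.instance Definition _ (A : finZmodType) :=
  Discrete_ofNbhs.Build (letter A) erefl.
HB.instance Definition _ (A : finZmodType) :=
  DiscreteUniform_ofNbhs.Build (letter A).
HB.instance Definition _ {R : numDomainType} (A : finZmodType) :=
  @DiscretePseudoMetric_ofUniform.Build R (letter A).

(** A Cauchy filter contains a set of diameter 0, hence a singleton. *)
Lemma letter_complete (A : finZmodType) (F : set_system (letter A)) :
  ProperFilter F -> cauchy F -> cvg F.
Proof.
move=> FF Fc.
have : entourage (diagonal : set (letter A * letter A)).
  by rewrite uniform_discrete => _ [x _ <-].
move=> /Fc[/= [U V] [FU FV] UV].
have [x [Ux Vx]] := filter_ex (filterI FU FV).
apply/cvg_ex; exists x; apply/discrete_cvg.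
by apply: filterS FV => y Vy /=; symmetry; exact: (UV (x, y)).
Qed.

HB.instance Definition _ (A : finZmodType) :=
  Uniform_isComplete.Build (letter A) (@letter_complete A).

Lemma polish_letter (R : realType) (A : finZmodType) :
  polish_space R (letter A).
Proof.
split.
  exists setT; first exact: countableP.
  by move=> U U0 _; rewrite setIT.
exists (letter A : completePseudoMetricType R), idfun, idfun; split => //.
- by move=> x y; exact: discrete_hausdorff.
- by move=> x; exact: cvg_id.
- by move=> x; exact: cvg_id.
Qed.

(** * Recovering a configuration from one letter per time *)

(** As [cell k.+1] is [cell k] or its left neighbour, each new letter enlarges
    the known interval by exactly one cell; halving makes the interval grow
    without bound on both sides. *)
Definition cell (k : nat) : int := - (k./2)%:Z.

(** V k i stands for: the letter of X_k at cell i is known. The two closure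
    hypotheses are the two ways to solve X_(k+1) i = X_k i + X_k (i + 1).
    Leaving the meaning of V open lets the same induction serve both for the
    determinism of letters ([cells_determine]) and for their measurability
    ([tau_filtrationE]). *)
Lemma spread_window (V : nat -> int -> Prop) :
  (forall k i, V k i -> V k.+1 i -> V k (i + 1)) ->
  (forall k i, V k (i + 1) -> V k.+1 i -> V k i) ->
  forall m k, (forall l, (k <= l <= k + m)%N -> V l (cell l)) ->
  forall j, (j <= m)%N -> V k (cell (k + m) + j%:Z).
Proof.
move=> Vright Vleft; elim=> [|m IHm] k Vcell j jm.
  by rewrite (_ : cell _ + _ = cell k); [apply: Vcell; lia|rewrite /cell; lia].
have Vk1 l : (l <= m)%N -> V k.+1 (cell (k + m.+1) + l%:Z).
  rewrite addnS -addSn; apply: IHm => l' ?; apply: Vcell; lia.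
have Vk : V k (cell k) by apply: Vcell; lia.
(* The letter read at time k lies in the window of m + 2 cells to be filled. *)
have [c [cm cE]] : exists c, (c <= m.+1)%N /\ cell k = cell (k + m.+1) + c%:Z.
  by exists ((k + m.+1)./2 - k./2)%N; rewrite /cell; lia.
rewrite cE in Vk.
have up d : (c + d <= m.+1)%N -> V k (cell (k + m.+1) + (c + d)%N%:Z).
  elim: d => [|d IHd] cd; first by rewrite addn0.
  rewrite (_ : _ + _ = cell (k + m.+1) + (c + d)%N%:Z + 1); last lia.
  by apply: Vright; [apply: IHd|apply: Vk1]; lia.
have down d : (d <= c)%N -> V k (cell (k + m.+1) + (c - d)%N%:Z).
  elim: d => [|d IHd] cd; first by rewrite subn0.
  apply: Vleft; last by apply: Vk1; lia.
  rewrite (_ : _ + 1 = cell (k + m.+1) + (c - d)%N%:Z); last lia.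
  by apply: IHd; lia.
have [cj|jc] := leqP c j.
  by rewrite -(subnKC cj); apply: up; lia.
by rewrite -(subKn (ltnW jc)); apply: down; lia.
Qed.

Lemma spread_everywhere (V : nat -> int -> Prop) (k0 : nat) :
  (forall k i, V k i -> V k.+1 i -> V k (i + 1)) ->
  (forall k i, V k (i + 1) -> V k.+1 i -> V k i) ->
  (forall k, (k0 <= k)%N -> V k (cell k)) ->
  forall k i, (k0 <= k)%N -> V k i.
Proof.
move=> Vright Vleft Vcell k i k0k.
(* With this many readings the window reaches from - |i| - k to |i|. *)
have [j [jm ->]] : exists j, (j <= `|i|.*2 + k)%N /\
    i = cell (k + (`|i|.*2 + k)) + j%:Z.
  by exists (absz (i + `|i|%N%:Z + k%:Z)); rewrite /cell; lia.
apply: (spread_window Vright Vleft _ jm) => l /andP[kl _].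
by apply: Vcell; exact: leq_trans k0k kl.
Qed.

Section Cellular.
Variable A : finZmodType.
Implicit Types x y : config A.

Lemma iter_tauS k x i :
  iter k.+1 (@tau A) x i =
    (iter k (@tau A) x i : A) + iter k (@tau A) x (i + 1).
Proof. by rewrite iterS. Qed.

Lemma iter_tau_local k x y i :
  (forall l, (l <= k)%N -> x (i + l%:Z) = y (i + l%:Z)) ->
  iter k (@tau A) x i = iter k (@tau A) y i.
Proof.
elim: k i => [|k IHk] i xy; first by have := xy 0%N; rewrite addr0; apply.
rewrite !iter_tauS; congr (_ + _); apply: IHk => l lk.
  by apply: xy; exact: leqW.
by rewrite -addrA -PoszD add1n; apply: xy.
Qed.

Lemma cells_determine N x y :
  (forall k, (k <= N)%N ->
     iter k (@tau A) x (cell k) = iter k (@tau A) y (cell k)) ->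
  forall l, (l <= N)%N -> x (cell N + l%:Z) = y (cell N + l%:Z).
Proof.
move=> xy l lN.
pose V k i := iter k (@tau A) x i = iter k (@tau A) y i.
apply: (@spread_window V _ _ N 0%N) => // k i; rewrite /V !iter_tauS.
- by move=> -> /addrI.
- by move=> -> /addIr.
Qed.

Definition extend0 (N : nat) (w : {ffun 'I_N.+1 -> A}) : config A :=
  fun i => if i - cell N is Posz l then w (inord l) else 0.

Definition window (N : nat) x : {ffun 'I_N.+1 -> A} :=
  [ffun l : 'I_N.+1 => x (cell N + l%:Z)].

Definition readings (N : nat) x : {ffun 'I_N.+1 -> A} :=
  [ffun k : 'I_N.+1 => iter k (@tau A) x (cell k)].

Lemma extend0E N (w : {ffun 'I_N.+1 -> A}) l : (l <= N)%N ->
  extend0 w (cell N + l%:Z) = w (inord l).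
Proof. by move=> lN; rewrite /extend0 addrC addKr. Qed.

(** For k <= N the k-th reading depends on the k + 1 cells from cell k on, and
    these lie among the N + 1 cells from cell N on. *)
Lemma readings_window N x : readings N x = readings N (extend0 (window N x)).
Proof.
apply/ffunP => k; rewrite !ffunE; apply: iter_tau_local => l lk.
have kN := ltn_ord k.
have -> : cell k + l%:Z = cell N + (N./2 - k./2 + l)%N%:Z by rewrite /cell; lia.
have lN : (N./2 - k./2 + l <= N)%N by lia.
by rewrite extend0E// ffunE inordK.
Qed.

Lemma readings_extend0_inj N :
  injective (fun w : {ffun 'I_N.+1 -> A} => readings N (extend0 w)).
Proof.
move=> w v /ffunP wv; apply/ffunP => l.
have lN : (l <= N)%N by rewrite -ltnS.
have := @cells_determine N (extend0 w) (extend0 v) _ l lN.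
rewrite !extend0E// inord_val; apply => k kN.
by have := wv (Ordinal (kN : (k < N.+1)%N)); rewrite !ffunE.
Qed.

(** An injective self-map of the finite set A^(N+1) is bijective, so preimages
    of boxes have the cardinal of the box. *)
Lemma card_readings N (B : nat -> {set A}) :
  #|[set w : {ffun 'I_N.+1 -> A} |
     [forall k : 'I_N.+1, readings N (extend0 w) k \in B k]]%SET| =
  (\prod_(k < N.+1) #|B k|)%N.
Proof.
transitivity #|(fun w : {ffun 'I_N.+1 -> A} => readings N (extend0 w)) @^-1:
                 [set v in family (fun k : 'I_N.+1 => mem (B k))]%SET|.
  by apply: eq_card => w; rewrite !inE; apply/forallP/forallP => h k; exact: h.
rewrite on_card_preimset; last exact/onW_bij/injF_bij/readings_extend0_inj.
by rewrite cardsE card_family foldrE big_map -big_enum.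
Qed.

End Cellular.

(** * The Borel sets of the configuration space *)

Section Cylinders.
Variable A : finZmodType.
Implicit Types x y : config A.

(** A neighbourhood for pointwise convergence constrains finitely many cells,
    all of them among the first N in an enumeration of the integers. *)
Lemma open_cylinder (U : set (config A)) x : open U -> U x ->
  exists N, forall y, (forall i : int, (pickle i < N)%N -> y i = x i) -> U y.
Proof.
move=> oU Ux.
pose C N := [set y : config A | forall i : int, (pickle i < N)%N -> y i = x i].
have FF : Filter (filter_from setT C).
  apply: filter_from_filter; first by exists 0%N.
  move=> M N _ _; exists (maxn M N) => // y yx; split=> i iN; apply: yx.
    by rewrite leq_max iN.
  by rewrite leq_max iN orbT.
(* The filter of the cylinders around x converges coordinatewise, hence is finer
   than the neighbourhoods of x. *)
have : filter_from setT C --> x.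
  apply/cvg_sup => i V [W [[Q oQ <-] Wx] WV].
  exists (pickle i).+1 => // y yx; apply: WV => /=.
  by rewrite (yx _ (ltnSn _)).
move=> /(_ U (open_nbhs_nbhs (conj oU Ux))) [N _ CU].
by exists N.
Qed.

(** The Borel sigma-algebra is generated by the coordinates, because every open
    set is a union of cylinders and there are only countably many of them: they
    are indexed by finite words s, listing the letters at the first [size s]
    cells of an enumeration of the integers. *)
Lemma measurable_config d (T : measurableType d) (f : T -> config A) :
  (forall i a, measurable [set t | f t i = a]) ->
  forall B, @measurable _ (borel (config A)) B -> measurable (f @^-1` B).
Proof.
move=> mf.
have mcyl (s : seq A) : measurable
    [set t | forall i : int,
       (pickle i < size s)%N -> f t i = nth 0 s (pickle i)].
  rewrite (_ : mkset _ = \bigcap_(k in `I_(size s))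
      [set t | forall i : int, pickle i = k -> f t i = nth 0 s k]).
    apply: bigcap_measurableType => k _.
    case ik : (@pickle_inv int k) => [i|].
      rewrite (_ : mkset _ = [set t | f t i = nth 0 s k]); first exact: mf.
      have ki : pickle i = k by have := @pickle_invK int k; rewrite ik.
      apply/seteqP; split=> t /= h; first exact: h.
      by move=> j jk; have := pickleK_inv j; rewrite jk ik => -[<-].
    rewrite (_ : mkset _ = setT)//; apply/seteqP; split=> // t _ j jk.
    by have := pickleK_inv j; rewrite jk ik.
  apply/seteqP; split=> t h; first by move=> k ks i ik; rewrite -ik h// ik.
  by move=> i ks; exact: (h _ ks).
suff : <<s @open (config A) >> `<=` [set B | measurable (f @^-1` B)] by exact.
apply: smallest_sub.
  split=> [|B /= mB|F mF] /=; first by rewrite preimage_set0.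
    by rewrite setTD preimage_setC; exact: measurableC.
  by rewrite preimage_bigcup; exact: bigcupT_measurable.
move=> U oU /=.
pose cyl (s : seq A) : set (config A) :=
  [set x | forall i : int, (pickle i < size s)%N -> x i = nth 0 s (pickle i)].
rewrite (_ : f @^-1` U =
    \bigcup_(s : seq A) [set t | cyl s `<=` U /\ cyl s (f t)]).
  apply: countable_bigcupT_measurable; first exact: countableP.
  move=> s; have [sU|sU] := pselect (cyl s `<=` U).
    rewrite (_ : mkset _ = [set t | cyl s (f t)]); first exact: mcyl.
    by apply/seteqP; split=> t // -[].
  by rewrite (_ : mkset _ = set0)//; apply/seteqP; split=> t // -[].
apply/seteqP; split=> [t /= Uft|t [s _ [sU /sU]]//].
have [N NU] := open_cylinder oU Uft.
pose s := mkseq (fun k => if unpickle k is Some i then f t i else 0) N.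
have sE (i : int) : (pickle i < N)%N -> nth 0 s (pickle i) = f t i.
  by move=> iN; rewrite nth_mkseq// pickleK.
have sN : size s = N by rewrite size_mkseq.
exists s => //; split=> [x /= xs|i /=].
  by apply: NU => i iN; rewrite xs ?sN// sE.
by rewrite sN => iN; rewrite sE.
Qed.

Lemma measurable_coord (i : int) (a : A) :
  @measurable _ (borel (config A)) [set x | x i = a].
Proof.
apply: sub_sigma_algebra.
have aopen : open ([set a] : set (discrete_topology A)) by exact: discrete_open.
have /continuousP/(_ _ aopen) :
    continuous (fun x : config A => x i : discrete_topology A).
  exact: (@proj_continuous int (fun=> discrete_topology A) i).
exact.
Qed.

End Cylinders.

(** * The filtration is generated by the readings *)

Section FiniteValued.
Context d (T : measurableType d) (A B C : finType).

Lemma measurable_preimage_fin (f : T -> A) (D : set A) :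
  (forall a, measurable [set t | f t = a]) -> measurable (f @^-1` D).
Proof.
move=> mf; rewrite (_ : _ @^-1` _ = \bigcup_(a in D) [set t | f t = a]).
  by apply: fin_bigcup_measurable => //; exact: finite_finset.
by apply/seteqP; split=> t /=; [exists (f t)|move=> [a Da ->]].
Qed.

Lemma measurable_level2 (op : A -> B -> C) (f : T -> A) (g : T -> B) :
  (forall a, measurable [set t | f t = a]) ->
  (forall b, measurable [set t | g t = b]) ->
  forall c, measurable [set t | op (f t) (g t) = c].
Proof.
move=> mf mg c.
rewrite (_ : mkset _ = \bigcup_(p in [set p : A * B | op p.1 p.2 = c])
    ([set t | f t = p.1] `&` [set t | g t = p.2])).
  apply: fin_bigcup_measurable => [|p _]; first exact: finite_finset.
  exact: measurableI.
by apply/seteqP; split=> t /=; [exists (f t, g t)|move=> [[a b] /= <- [-> ->]]].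
Qed.

End FiniteValued.

Lemma Sigma_subset d (T : measurableType d) (R : realType) (P : probability T R)
    (E F : int -> ptopologicalType) (X : forall n, T -> E n)
    (Y : forall n, T -> F n) (I J : set int) :
  (forall m, I m -> forall B, @measurable _ (borel (E m)) B ->
     Sigma P Y J (X m @^-1` B)) ->
  Sigma P X I `<=` Sigma P Y J.
Proof.
move=> XY; apply: smallest_sub; first exact: smallest_sigma_algebra.
move=> U [[m Im [B mB <-]]|C0]; first by rewrite setTI; exact: XY.
by apply: sub_sigma_algebra; right.
Qed.

Section Readings.
Variable A : finZmodType.

Definition reading (n : int) (x : borel (config A)) : letter A :=
  tau_process n x (cell `|n|%N).

Lemma measurable_iter_tau k i a :
  @measurable _ (borel (config A)) [set x | iter k (@tau A) x i = a].
Proof.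
elim: k i a => [|k IHk] i a; first exact: measurable_coord.
exact: (measurable_level2 (fun b c : A => b + c) (IHk i) (IHk (i + 1))).
Qed.

Lemma random_process_reading : random_process reading.
Proof.
move=> n _ _ B mB; rewrite setTI.
by apply: (@measurable_preimage_fin _ _ A) => a; exact: measurable_iter_tau.
Qed.

Variables (R : realType) (mu : probability (borel (config A)) R).

(** Each letter of X_k is obtained by finitely many subtractions from readings
    at times at least as remote as k, hence is measurable for the sigma-algebra
    that they generate. *)
Lemma tau_filtrationE n : n <= 0 ->
  tau_filtration mu n = generated_filtration mu reading n.
Proof.
move=> n0; apply/seteqP; split; apply: Sigma_subset => m /= mn B mB; last first.
  apply: sub_sigma_algebra; left; exists m => //.
  exists [set x : config A | B (x (cell `|m|%N))]; last by rewrite setTI.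
  apply: (@measurable_preimage_fin _ (borel (config A)) A) => a.
  exact: measurable_coord.
pose V k i := forall a,
  Sigma mu reading [set m : int | m <= n] [set x | iter k (@tau A) x i = a].
pose G := g_sigma_algebraType ((\bigcup_(m in [set m : int | m <= n])
  preimage_set_system setT (reading m) (@measurable _ (borel (letter A))))
   `|` mu.-negligible).
suff mV i : V `|m|%N i by exact: (@measurable_config A _ G).
apply: (@spread_everywhere V `|n|%N) => [k j mk mk1|k j mk mk1|k nk a|].
- rewrite /V => a; rewrite (_ : mkset _ = [set x |
      (iter k.+1 (@tau A) x j : A) - iter k (@tau A) x j = a]).
    exact: (@measurable_level2 _ G A A A (fun b c => b - c) _ _ mk1 mk).
  by apply/seteqP; split=> x; rewrite /mkset iter_tauS addrAC subrr add0r.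
- rewrite /V => a; rewrite (_ : mkset _ = [set x |
      (iter k.+1 (@tau A) x j : A) - iter k (@tau A) x (j + 1) = a]).
    exact: (@measurable_level2 _ G A A A (fun b c => b - c) _ _ mk1 mk).
  by apply/seteqP; split=> x; rewrite /mkset iter_tauS addrK.
- apply: sub_sigma_algebra; left; exists (- k%:Z); first by rewrite /=; lia.
  exists [set a]; first by apply: sub_sigma_algebra; exact: discrete_open.
  by rewrite setTI /reading /tau_process abszN absz_nat.
- by lia.
Qed.

(** * Independence of the readings *)

Hypothesis hmu : uniform_product_measure mu.

Let cardA_neq0 : #|A|%:R != 0 :> R.
Proof. by rewrite pnatr_eq0 -lt0n; apply/card_gt0P; exists 0. Qed.

Lemma mu_window N (w : {ffun 'I_N.+1 -> A}) :
  mu [set x | window N x = w] = (#|A|%:R^-1 ^+ N.+1)%:E.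
Proof.
pose s := [seq cell N + l%:Z | l <- index_iota 0 N.+1].
rewrite (_ : mkset _ = [set x : config A | forall i,
    i \in seq_fset tt s -> (x i : A) \in [set extend0 w i]%SET]).
  rewrite hmu; congr EFin; under eq_bigr do rewrite cards1 div1r.
  rewrite (perm_big s); first by rewrite big_map prodr_const_nat subn0.
  apply: uniq_perm; first exact: fset_uniq.
    by rewrite map_inj_uniq ?iota_uniq// => l l' /addrI[].
  exact: seq_fsetE.
apply/seteqP; split=> x; rewrite /mkset.
  move=> <- i; rewrite seq_fsetE finset.in_set1 => /mapP[l].
  rewrite mem_index_iota ltnS => /= lN ->.
  by rewrite extend0E// ffunE inordK.
move=> xw; apply/ffunP => l; have lN : (l <= N)%N by rewrite -ltnS.
have := xw (cell N + l%:Z).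
rewrite seq_fsetE finset.in_set1 extend0E// inord_val ffunE.
move=> h; apply/eqP/h/mapP; exists (l : nat) => //.
by rewrite mem_index_iota /=.
Qed.

Lemma measurable_window N (w : {ffun 'I_N.+1 -> A}) :
  @measurable _ (borel (config A)) [set x | window N x = w].
Proof.
rewrite (_ : mkset _ = \bigcap_(l in [set: 'I_N.+1])
    [set x : config A | x (cell N + (l : nat)%:Z) = w l]).
  apply: fin_bigcap_measurable => [|l _]; first exact: finite_finset.
  exact: measurable_coord.
apply/seteqP; split=> [x /= <- l _|x xw] /=; first by rewrite ffunE.
by apply/ffunP => l; rewrite ffunE; exact: xw.
Qed.

(** The joint law of the first N + 1 readings is uniform on A^(N+1). *)
Lemma mu_readings N (B : nat -> {set A}) :
  mu [set x | forall k, (k <= N)%N -> iter k (@tau A) x (cell k) \in B k] =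
  (\prod_(k < N.+1) (#|B k|%:R / #|A|%:R))%:E.
Proof.
pose S := [set w : {ffun 'I_N.+1 -> A} |
  [forall k : 'I_N.+1, readings N (extend0 w) k \in B k]]%SET.
rewrite (_ : mkset _ = \bigcup_(w in [set` S]) [set x | window N x = w]).
  rewrite measure_fin_bigcup; last 3 first.
  - exact: finite_finset.
  - by move=> w v _ _ [x [/= <- <-]].
  - by move=> w _; exact: measurable_window.
  rewrite -(@bigfs _ _ _ _ (index_enum _) (mem S)) ?index_enum_uniq//; last first.
    by move=> w _; rewrite mem_index_enum.
  rewrite (eq_bigr (fun=> (#|A|%:R^-1 ^+ N.+1)%:E)); last first.
    by move=> w _; exact: mu_window.
  rewrite sumEFin sumr_const card_readings prodf_div prodr_const card_ord.
  by rewrite -natr_prod exprVn mulr_natl.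
apply/seteqP; split=> [x /= xB|x [w /= wS xw] k kN].
  exists (window N x) => //=; rewrite inE; apply/forallP => k.
  by rewrite -readings_window ffunE; apply: xB; rewrite -ltnS.
move: wS; rewrite inE => /forallP/(_ (Ordinal (kN : (k < N.+1)%N))).
by rewrite -xw -readings_window ffunE.
Qed.

Lemma mu_reading_bigcap (J : {fset int}) (B : forall n : int, set (letter A)) :
  (forall n, n \in J -> n <= 0) ->
  mu (\bigcap_(n in [set` J]) (reading n @^-1` B n)) =
  (\prod_(n <- J) (#|[set a : A | a \in B n]%SET|%:R / #|A|%:R))%:E.
Proof.
move=> J0; pose N := \max_(n <- J) `|n|%N.
have JN n : n \in J -> (`|n| <= N)%N.
  by move=> nJ; rewrite /N (big_rem n)//= leq_maxl.
(* Pad J to the full range of times 0, ..., -N with trivial constraints. *)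
pose C k : {set A} :=
  if - k%:Z \in J then [set a : A | a \in B (- k%:Z)]%SET else [set: A]%SET.
transitivity (mu [set x | forall k, (k <= N)%N ->
    iter k (@tau A) x (cell k) \in C k]).
  congr (mu _); apply/seteqP; split=> x /= xB.
    move=> k kN; rewrite /C.
    case: ifPn => [kJ|_]; last by rewrite finset.in_setT.
    rewrite finset.in_set; apply/mem_set.
    by have := xB _ kJ; rewrite /= /reading /tau_process abszN absz_nat.
  move=> n /= nJ; have nE : n = - `|n|%N%:Z by have := J0 _ nJ; lia.
  have := xB _ (JN _ nJ); rewrite /C -nE nJ finset.in_set => /set_mem.
  by rewrite /reading /tau_process.
rewrite mu_readings; congr EFin.
rewrite -(big_mkord xpredT (fun k => #|C k|%:R / #|A|%:R)).
rewrite (eq_bigr (fun k : nat => if - k%:Z \in J then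
    #|[set a : A | a \in B (- k%:Z)]%SET|%:R / #|A|%:R else 1)); last first.
  by move=> k _; rewrite /C; case: ifP; rewrite // cardsT divff.
rewrite -big_mkcond -big_filter -(big_map (fun k : nat => - k%:Z) xpredT
  (fun n => #|[set a : A | a \in B n]%SET|%:R / #|A|%:R)).
apply/perm_big/uniq_perm; last 2 first.
- exact: fset_uniq.
- move=> n; apply/mapP/idP => [[k]|nJ].
    by rewrite mem_filter => /andP[kJ _] ->.
  have nE : n = - `|n|%N%:Z by have := J0 _ nJ; lia.
  by exists `|n|%N => //; rewrite mem_filter -nE nJ mem_index_iota ltnS JN.
rewrite map_inj_uniq ?filter_uniq ?iota_uniq// => k l.
by move=> /oppr_inj[].
Qed.

Lemma independent_process_reading : independent_process mu reading.
Proof.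
move=> J B J0 _; rewrite mu_reading_bigcap// -prodEFin.
apply: eq_big_seq => n nJ.
have := @mu_reading_bigcap [fset n]%fset B.
rewrite big_seq_fset1 => <-; last by move=> m; rewrite inE => /eqP ->; exact: J0.
congr (mu _); apply/seteqP; split=> x xB.
  by apply: (xB n); rewrite /= inE.
by move=> m /=; rewrite inE => /eqP ->.
Qed.

End Readings.

Theorem theorem2p5 (R : realType) (A : finZmodType) (hA : (2 <= #|A|)%N)
  (mu : probability (borel (config A)) R) (hmu : uniform_product_measure mu) :
  product_type mu (tau_filtration mu).
Proof.
exists (fun=> letter A), (@reading A); split.
- by move=> n; exact: polish_letter.
- exact: random_process_reading.
- exact: independent_process_reading.
- by move=> n n0; exact: tau_filtrationE.
Qed.
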